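(* Let $X$ be a linear subspace of $L^0$, $s\in(0,1]$, $n\ge2$, let $\rho_1,\dots,\rho_{n-1}$ be $s$-convex semimodulars on $X$, and put $\rho=\max_{1\le i\le n-1}\rho_i$ and $X_\rho=\{x\in X:\rho(\lambda x)<\infty\text{ for some }\lambda>0\}$. Assume: (i) for any $x\in X_\rho$ and $y\in L^0$ with $|y|\le|x|$ a.e., we have $y\in X_\rho$ and $\rho_i(\lambda y)\le\rho_i(\lambda x)$ for all $\lambda>0$ and $i\in\{1,\dots,n-1\}$; (ii) there is $x\in X_\rho$ with $x>0$ a.e.; (iii) for any $(x_m)\subset X_\rho$ such that $\rho(\lambda(x_k-x_j))\to0$ as $k,j\to\infty$ for every $\lambda>0$, there is $x\in X_\rho$ with $\rho(\lambda(x_m-x))\to0$ as $m\to\infty$ for every $\lambda>0$. Let $f:\mathbb{R}^n\to[0,+\infty)$ be a norm such that $f(1,x_2,\dots,x_n)\le f(1,y_2,\dots,y_n)$ whenever $0\le x_j\le y_j$ for $j=2,\dots,n$, and for $x\in X_\rho$ let $$\|x\|_f=\inf_{k>0}\left\{k f\left(e_1+\sum_{i=2}^n\rho_{i-1}\left(\frac{x}{k^{1/s}}\right)e_i\right)\right\}.$$ Then the $s$-norm $\|\cdot\|_f$ is order continuous if and only if for any $\lambda>0$ and any $(x_m)\subset(X_\rho)^+$ with $x_m\downarrow0$ a.e. we have $\rho(\lambda x_m)\to0$.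
   Context: $I=[0,\alpha)$ with $\alpha=1$ or $\alpha=\infty$, with Lebesgue measure; $L^0$ is the set of (a.e. equivalence classes of) extended real-valued Lebesgue measurable functions on $I$. $(e_i)$ is the standard basis of $\mathbb{R}^n$; $(X_\rho)^+=\{x\in X_\rho:x\ge0\text{ a.e.}\}$. A function $\rho:X\to[0,\infty]$ is an $s$-convex semimodular if: $\rho(0)=0$, and $\rho(dx)=0$ for all $d\ge0$ implies $x=0$; $\rho(dx)=\rho(x)$ for scalars $|d|=1$; $\rho(ax+by)\le a^s\rho(x)+b^s\rho(y)$ for $a,b\ge0$, $a^s+b^s=1$. Convention: $f(e_1+\sum_{i=2}^nt_ie_i)=+\infty$ if some $t_i=+\infty$. The $s$-norm $\|\cdot\|_f$ on $X_\rho$ is order continuous if for every $x\in X_\rho$ and every sequence $(x_m)\subset(X_\rho)^+$ with $x_m\le|x|$ and $x_m\to0$ a.e., we have $\|x_m\|_f\to0$. *)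

(* Defs.v *)
From HB Require Import structures.
From mathcomp Require Import all_boot all_order all_algebra.
From mathcomp Require Import all_classical all_reals all_analysis.
From mathcomp Require Import measurable_realfun.
Import Order.TTheory GRing.Theory Num.Theory.
Import numFieldNormedType.Exports.

Set Implicit Arguments.
Unset Strict Implicit.
Unset Printing Implicit Defensive.

Local Open Scope classical_set_scope.
Local Open Scope ring_scope.

(* The real line with the sigma-algebra of Lebesgue measurable sets, i.e. the
   domain of completed_lebesgue_measure. It is convertible to R. *)
Definition leb_type (R : realType) : measurableType _ :=
  caratheodory_type (@wlength R idfun)^*%mu.

Definition leb (R : realType) : {measure set (leb_type R) -> \bar R} :=
  @completed_lebesgue_measure R.

Definition base_itv (R : realType) (alpha : \bar R) : set (leb_type R) :=
  [set t : R | 0 <= t /\ (t%:E < alpha)%E].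

(* A class of functions on I modulo a.e. equality is represented by functions on
   the whole line; their values outside of I are irrelevant because everything
   below is relativised to I. *)
Section function_spaces.
Context {R : realType}.
Local Open Scope ereal_scope.

Notation fct := (leb_type R -> \bar R).

Implicit Types (I : set (leb_type R)) (X : set fct) (x y : fct)
  (rho N : fct -> \bar R) (s : R).

Definition fscale (a : R) x : fct := fun t => a%:E * x t.
Definition fadd x y : fct := fun t => x t + y t.
Definition fsub x y : fct := fun t => x t - y t.

Definition L0 I : set fct := [set x : fct | measurable_fun I x].

(* Sums of extended real-valued functions are only meaningful for functions that
   are finite a.e., and cancellation in a vector space (x - x = 0) forces its
   elements to be so. The second condition makes X a set of classes. *)
Definition linear_subspace I X : Prop :=
  [/\ X `<=` L0 I,
      (forall x y, X x -> L0 I y -> x = y %[ae (leb R) in I] -> X y),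
      (forall x, X x -> {ae leb R, forall t, I t -> x t \is a fin_num}),
      X (cst 0) &
      (forall x y, X x -> X y -> X (fadd x y)) /\
      (forall (a : R) x, X x -> X (fscale a x))].

(* rho is well-defined on classes, takes values in [0, +oo] on X, and satisfies
   the axioms of s-convex semimodulars there; its values outside of X are
   irrelevant. *)
Definition sconvex_semimodular I X s rho : Prop :=
  [/\ (forall x y, X x -> X y -> x = y %[ae (leb R) in I] -> rho x = rho y) /\
      (forall x, X x -> 0 <= rho x),
      rho (cst 0) = 0,
      (forall x, X x -> (forall d : R, (0 <= d)%R -> rho (fscale d x) = 0) ->
         x = cst 0 %[ae (leb R) in I]),
      (forall x (d : R), X x -> `|d|%R = 1%R -> rho (fscale d x) = rho x) &
      (forall x y (a b : R), X x -> X y -> (0 <= a)%R -> (0 <= b)%R ->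
         (a `^ s + b `^ s)%R = 1%R ->
         rho (fadd (fscale a x) (fscale b y)) <=
         (a `^ s)%:E * rho x + (b `^ s)%:E * rho y)].

Definition modular_space X rho : set fct :=
  [set x | X x /\ exists2 lambda : R, (0 < lambda)%R &
                    rho (fscale lambda x) < +oo].

(* the maximum of rho_1, ..., rho_{n-1}; the members of the family with other
   indices are not used *)
Definition max_modular (n : nat) (rho : nat -> fct -> \bar R) : fct -> \bar R :=
  fun x => \big[maxe/-oo]_(1 <= i < n) rho i x.

Definition nonneg_part I (Y : set fct) : set fct :=
  [set x | Y x /\ {ae leb R, forall t, I t -> 0 <= x t}].

Definition ae_cvg0 I (x_ : nat -> fct) : Prop :=
  {ae leb R, forall t, I t -> x_ m t @[m --> \oo] --> 0}.

Definition ae_decreases_to0 I (x_ : nat -> fct) : Prop :=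
  {ae leb R, forall t, I t ->
    (forall m, x_ m.+1 t <= x_ m t) /\ x_ m t @[m --> \oo] --> 0}.

Definition order_continuous I (Y : set fct) N : Prop :=
  forall x (x_ : nat -> fct), Y x -> (forall m, nonneg_part I Y (x_ m)) ->
    (forall m, {ae leb R, forall t, I t -> x_ m t <= `|x t|}) ->
    ae_cvg0 I x_ -> N (x_ m) @[m --> \oo] --> 0.

End function_spaces.

Definition is_norm (R : realType) (n : nat) (f : 'rV[R]_n -> R) : Prop :=
  [/\ (forall u, 0 <= f u),
      (forall u, f u = 0 -> u = 0),
      (forall (a : R) u, f (a *: u) = `|a| * f u) &
      (forall u v, f (u + v) <= f u + f v)].

(* The vector e_1 + \sum_(2 <= i <= n) t_(i-1) e_i = (1, t_1, ..., t_{n-1}). As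
   columns are numbered from 0, its entry in a column j > 0 is t_j. *)
Definition e1_plus (R : realType) (n : nat) (t : nat -> R) : 'rV[R]_n :=
  \row_(j < n) (if j == 0%N :> nat then 1 else t j).

(* f (1, t_1, ..., t_{n-1}) for t_i in [0, +oo], equal to +oo if some t_i is *)
Definition ext_f (R : realType) (n : nat) (f : 'rV[R]_n -> R)
    (t : nat -> \bar R) : \bar R :=
  if [exists j : 'I_n, (0 < j)%N && (t j == +oo%E)] then +oo%E
  else (f (e1_plus n (fun i => fine (t i))))%:E.

Definition f_norm (R : realType) (s : R) (n : nat) (f : 'rV[R]_n -> R)
    (rho : nat -> (leb_type R -> \bar R) -> \bar R) (x : leb_type R -> \bar R) :
    \bar R :=
  ereal_inf [set (k%:E *
      ext_f f (fun i => rho i (fscale (k `^ s^-1)^-1 x)))%E |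
    k in [set k : R | 0 < k]].

(* Main.v *)
Require Import Defs.
From HB Require Import structures.
From mathcomp Require Import all_boot all_order all_algebra.
From mathcomp Require Import all_classical all_reals all_analysis.
From mathcomp Require Import measurable_realfun.
From mathcomp Require Import ring lra.
Import Order.TTheory GRing.Theory Num.Theory.
Import numFieldNormedType.Exports.

Set Implicit Arguments.
Unset Strict Implicit.
Unset Printing Implicit Defensive.

Local Open Scope classical_set_scope.
Local Open Scope ring_scope.

(* Convergence to 0 for [||.||_f] is equivalent to [rho (lambda x_m) --> 0] for
   all [lambda > 0]. Indeed [f (1, t)] dominates [f (e_1)] and each
   [t_i f (e_i) / 2], so that a small value of [k f (1, rho (x / k^(1/s)))] makes
   both [k] and [k rho_i (x / k^(1/s))] small, and s-convexity compares the latter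
   with [rho_i (lambda x)]; conversely a fixed small [k] may be inserted in the
   infimum. Order continuity then reduces to decreasing sequences by replacing
   [x_m] with [sup_(j >= m) x_j]. *)

(** A bound [u m < e] with [e] real already forces a nonnegative [u m] to be finite, so epsilon
    arguments in [\bar R] need no separate finiteness condition. *)
Lemma nneg_cvge0P (R : realType) (u : (\bar R)^nat) : (forall m, 0 <= u m)%E ->
  u m @[m --> \oo] --> 0%E <->
  forall e : R, 0 < e -> \forall m \near \oo, (u m < e%:E)%E.
Proof.
move=> u0; split=> [/fine_cvgP[ufin /cvgrPdist_lt uc] e e0|uc].
  near=> m; have um : u m \is a fin_num by near: m.
  rewrite -(fineK um) lte_fin -[ltLHS]ger0_norm ?fine_ge0// -normrN -sub0r.
  by near: m; exact: uc.
have ufin : \forall m \near \oo, u m \is a fin_num.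
  near=> m; rewrite ge0_fin_numE//.
  by apply: (@lt_trans _ _ 1%:E); [near: m; exact: uc|exact: ltry].
apply/fine_cvgP; split=> //; apply/cvgrPdist_lt => e e0; near=> m.
have um : u m \is a fin_num by near: m.
rewrite sub0r normrN ger0_norm ?fine_ge0//= -lte_fin fineK//.
by near: m; exact: uc.
Unshelve. all: by end_near. Qed.

(** * Convergence to 0 of a finite maximum of semimodulars *)

Section max_modular.
Context {R : realType} (n : nat) (rho_ : nat -> (leb_type R -> \bar R) -> \bar R).

Lemma le_max_modular x i : (1 <= i < n)%N -> (rho_ i x <= max_modular n rho_ x)%E.
Proof. by move=> hi; apply: le_bigmax_seq; rewrite ?mem_index_iota. Qed.

Lemma max_modular_lt x (y : \bar R) : (-oo < y)%E ->
  (forall i, (1 <= i < n)%N -> (rho_ i x < y)%E) -> (max_modular n rho_ x < y)%E.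
Proof.
move=> y0 hy; rewrite /max_modular big_nat_cond.
elim/big_ind : _ => // [a b ha hb|i]; first by rewrite gt_max ha hb.
by rewrite andbT; exact: hy.
Qed.

(** Each member lies below the maximum, and finitely many eventual bounds hold simultaneously. As
    [2 <= n], the family is nonempty, so its maximum is nonnegative and not the initial value
    [-oo]. *)
Lemma max_modular_cvg0P (x_ : nat -> leb_type R -> \bar R) : (2 <= n)%N ->
  (forall i m, (1 <= i < n)%N -> (0 <= rho_ i (x_ m))%E) ->
  max_modular n rho_ (x_ m) @[m --> \oo] --> 0%E <->
  forall i, (1 <= i < n)%N -> rho_ i (x_ m) @[m --> \oo] --> 0%E.
Proof.
move=> n2 rho0; split=> [+ i hi|rhoc].
  apply: squeeze_cvge; last exact: cvg_cst.
  by apply: nearW => m; rewrite rho0//= le_max_modular.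
apply/nneg_cvge0P => [m|e e0].
  by apply: le_trans (le_max_modular _ (i := 1%N) _) => //; exact: rho0.
(* Indexing by the finite type ['I_n] allows the eventual bounds to be intersected; index 0 lies
   outside the family and is excluded by the guard. *)
suff : \forall m \near \oo, forall i : 'I_n, (0 < i)%N -> (rho_ i (x_ m) < e%:E)%E.
  apply: filterS => m rhoe; apply: max_modular_lt; rewrite ?ltNyr// => i /andP[i0 ni].
  exact: (rhoe (Ordinal ni)).
apply: filter_forall => i; have [i0|] := ltnP 0 i; last by move=> _; exact: nearW.
have : \forall m \near \oo, (rho_ i (x_ m) < e%:E)%E.
  have hi : (1 <= i < n)%N by rewrite i0/=.
  by apply/nneg_cvge0P : e e0; [move=> m; exact: rho0|exact: rhoc].
exact: filterS.
Qed.

End max_modular.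

(** * Bounds for [f (1, t_1, ..., t_{n-1})] from below and above *)

Section norm_e1_plus.
Context {R : realType} (n : nat) (f : 'rV[R]_n -> R).
Hypothesis n2 : (2 <= n)%N.
Hypothesis f_is_norm : is_norm f.
Hypothesis f_mono : forall u v : nat -> R,
  (forall j, (1 <= j < n)%N -> 0 <= u j /\ u j <= v j) ->
  f (e1_plus n u) <= f (e1_plus n v).

Let c := f (e1_plus n (cst 0)).

Lemma f_e1_gt0 : 0 < c.
Proof.
have [f0 fI _ _] := f_is_norm; rewrite lt_neqAle f0 andbT eq_sym; apply/eqP => /fI.
have n0 : (0 < n)%N by exact: leq_trans n2.
by move/rowP/(_ (Ordinal n0)); rewrite !mxE/= => /eqP; rewrite oner_eq0.
Qed.

Lemma ext_f_ge0 t : (0 <= ext_f f t)%E.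
Proof.
by have [f0 _ _ _] := f_is_norm; rewrite /ext_f; case: ifP => // _; rewrite lee_fin.
Qed.

(** By monotonicity, all entries of [t], or all but [t_j], may be replaced by 0 without increasing
    [f]. The first choice gives [c <= M]; the second gives [f (e_1 + t_j e_j) <= M], and subtracting
    [e_1] yields [t_j f (e_j) <= M + c <= 2 M]. *)
Lemma ext_f_lb : exists2 d : R, 0 < d &
  forall t (M : R), (forall j, (1 <= j < n)%N -> 0 <= t j)%E ->
    (ext_f f t <= M%:E)%E ->
    c <= M /\ (forall j, (1 <= j < n)%N -> t j <= (M / d)%:E)%E.
Proof.
have [f0 fI fZ fD] := f_is_norm.
pose g (j : 'I_n) := f (delta_mx 0 j).
have g0 j : 0 < g j.
  rewrite lt_neqAle f0 andbT eq_sym; apply/eqP => /fI /rowP/(_ j).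
  by rewrite !mxE !eqxx => /eqP; rewrite oner_eq0.
(* The initial value 1 is harmless: only [0 < d] and [d <= g j] matter, and the minimum gives one
   constant for all [j]. *)
pose d := \big[Num.min/1]_j g j.
have d0 : 0 < d by apply/bigmin_gtP; split.
have dg j : d <= g j by exact: bigmin_le.
exists (d / 2); first exact: divr_gt0.
move=> t M t0; rewrite /ext_f; case: ifP => [_|/existsPn tfin]; first by rewrite leye_eq.
rewrite lee_fin => fM; have cM : c <= M.
  apply: le_trans fM; apply: f_mono => j hj; split => //=.
  by rewrite fine_ge0// t0.
split=> // j /[dup] hj /andP[j0 jn]; pose J := Ordinal jn.
have tjfin : t j \is a fin_num.
  by have := tfin J; rewrite j0/= ge0_fin_numE ?t0// ltey.
pose u i := if i == j then fine (t j) else 0.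
have fu : f (e1_plus n u) <= M.
  apply: le_trans fM; apply: f_mono => i hi; rewrite /u.
  by have [->|_] := eqVneq i j; rewrite fine_ge0 ?t0.
have eu : fine (t j) *: delta_mx 0 J = e1_plus n u + (-1) *: e1_plus n (cst 0).
  apply/rowP => i; rewrite !mxE/= /u -val_eqE/=.
  have [->|_] := eqVneq (i : nat) j; last first.
  by case: ifP => _; rewrite mulr0 ?mulr1 ?addrN ?mulr0 ?addr0.
  by rewrite gtn_eqF// mulr1 mulr0 addr0.
have := fD (e1_plus n u) ((-1) *: e1_plus n (cst 0)).
rewrite -eu !fZ normrN normr1 mul1r ger0_norm ?fine_ge0 ?t0// -/c -/(g J) => tjg.
have tjd : fine (t j) * d <= fine (t j) * g J by rewrite ler_wpM2l ?fine_ge0 ?t0.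
by rewrite -(fineK tjfin) lee_fin ler_pdivlMr ?divr_gt0//; lra.
Qed.

(** Entries at most 1 are finite, and monotonicity compares them with the vector [(1, ..., 1)],
    whose norm is the bound. *)
Lemma ext_f_ub : exists2 M : R, 0 < M &
  forall t, (forall j, (1 <= j < n)%N -> 0 <= t j <= 1)%E -> (ext_f f t <= M%:E)%E.
Proof.
exists (f (e1_plus n (cst 1))).
  apply: (lt_le_trans f_e1_gt0); apply: f_mono => j _.
  by split; [exact: lexx|exact: ler01].
move=> t t01; rewrite /ext_f; case: ifP => [/existsP[j /andP[j0 /eqP tj]]|_].
  by have := t01 j; rewrite j0 ltn_ord tj leye_eq andbF => /(_ isT).
rewrite lee_fin; apply: f_mono => j /t01 /andP[tj0 tj1]; split; first exact: fine_ge0.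
have tjfin : t j \is a fin_num by rewrite ge0_fin_numE// (le_lt_trans tj1)// ltry.
by rewrite -lee_fin fineK.
Qed.

End norm_e1_plus.

(** * Convergence to 0 of [f_norm] and of the semimodulars *)

Section f_norm_convergence.
Context {R : realType} (I : set (leb_type R)) (X : set (leb_type R -> \bar R)) (s : R).
Hypothesis X_subspace : linear_subspace I X.
Hypothesis s_gt0 : 0 < s.

Lemma fscaleA (a b : R) (x : leb_type R -> \bar R) :
  fscale a (fscale b x) = fscale (a * b) x.
Proof. by apply/funext => t; rewrite /fscale EFinM muleA. Qed.

(** This is s-convexity with second point 0, where [rho] vanishes, and the complementary coefficient
    [b = (1 - a^s)^(1/s)]. *)
Lemma sconvex_fscale_le rho x (a : R) : sconvex_semimodular I X s rho -> X x ->
  0 <= a -> a `^ s <= 1 -> (rho (fscale a x) <= (a `^ s)%:E * rho x)%E.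
Proof.
move=> [_ rho0 _ _ rhoD] Xx a0 as1; have [_ _ _ X0 _] := X_subspace.
pose b := (1 - a `^ s) `^ s^-1.
have bs : b `^ s = 1 - a `^ s.
  by rewrite /b -powRrM mulVf ?gt_eqF// powRr1 ?subr_ge0.
have /= := rhoD x (cst 0%E) a b Xx X0 a0 (powR_ge0 _ _).
rewrite rho0 mule0 adde0 bs addrC subrK => /(_ erefl).
by congr (rho _ <= _)%E; apply/funext => t; rewrite /fadd /fscale /= mule0 adde0.
Qed.

Variables (n : nat) (rho_ : nat -> (leb_type R -> \bar R) -> \bar R).
Variable f : 'rV[R]_n -> R.
Hypothesis n2 : (2 <= n)%N.
Hypothesis rho_semimodular : forall i, (1 <= i < n)%N ->
  sconvex_semimodular I X s (rho_ i).
Hypothesis f_is_norm : is_norm f.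
Hypothesis f_mono : forall u v : nat -> R,
  (forall j, (1 <= j < n)%N -> 0 <= u j /\ u j <= v j) ->
  f (e1_plus n u) <= f (e1_plus n v).

Lemma semimodular_ge0 i x : (1 <= i < n)%N -> X x -> (0 <= rho_ i x)%E.
Proof. by move=> /rho_semimodular[[_ +] _ _ _ _]; exact. Qed.

Lemma subspace_fscale a x : X x -> X (fscale a x).
Proof. by have [_ _ _ _ [_ XZ]] := X_subspace; exact: XZ. Qed.

Lemma f_norm_ge0 x : (0 <= f_norm s f rho_ x)%E.
Proof.
apply: le_ereal_inf_tmp => _ [k /= k0 <-].
by apply: mule_ge0; [rewrite lee_fin ltW|exact: ext_f_ge0].
Qed.

(* If [k * ext_f (..) < e] then [k < e / f(e_1)] and
   [k * rho_i (x / k^(1/s)) < e / d]; once [lambda^s * k <= 1], convexity turns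
   the latter into a bound on [rho_i (lambda x)]. *)
Lemma f_norm_lt_semimodular_le (lambda : R) : 0 < lambda ->
  exists C D : R, [/\ 0 < C, 0 < D & forall x (e : R), X x -> 0 < e -> e <= D ->
    (f_norm s f rho_ x < e%:E)%E ->
    forall i, (1 <= i < n)%N -> (rho_ i (fscale lambda x) <= (C * e)%:E)%E].
Proof.
move=> l0; have c0 := f_e1_gt0 n2 f_is_norm.
have [d d0 fd] := ext_f_lb f_is_norm f_mono.
set c := f _ in c0 fd; pose ls := lambda `^ s; have ls0 : 0 < ls by exact: powR_gt0.
(* With the second constant, [e <= c / ls] and [c <= e / k] give [ls * k <= 1], as convexity
   requires. The first is the product of the convexity factor [ls * k] and the bound [e / k / d],
   divided by [e]; [k] cancels. *)
exists (ls / d), (c / ls); split; rewrite ?divr_gt0// => x e Xx e0 ec.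
move=> /ereal_inf_lt[_ [k /= k0 <-]]; set r := k `^ s^-1.
have r0 : 0 < r by exact: powR_gt0.
have rs : r `^ s = k by rewrite /r -powRrM mulVf ?gt_eqF// powRr1// ltW.
have Xrx : X (fscale r^-1 x) by exact: subspace_fscale.
set F := ext_f f _ => kF i hi.
have Fe : (F <= (e / k)%:E)%E.
  by rewrite mulrC EFinM lee_pdivlMl// ltW.
have [|ce rhod] := fd _ _ _ Fe.
  by move=> j hj; exact: semimodular_ge0.
have lk1 : ls * k <= 1.
  rewrite ler_pdivlMr// in ce; rewrite ler_pdivlMr// in ec.
  rewrite -(ler_pM2l c0) mulr1 mulrCA; apply: le_trans ec.
  by rewrite mulrC ler_pM2r.
have -> : fscale lambda x = fscale (lambda * r) (fscale r^-1 x).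
  by rewrite fscaleA mulfK// gt_eqF.
have lrs : (lambda * r) `^ s = ls * k by rewrite powRM ?rs// ltW.
apply: le_trans (sconvex_fscale_le (rho_semimodular hi) Xrx _ _) _.
- by rewrite mulr_ge0// ltW.
- by rewrite lrs.
rewrite lrs; apply: le_trans (lee_wpmul2l _ (rhod i hi)) _.
  by rewrite lee_fin mulr_ge0// ltW.
rewrite -EFinM lee_fin le_eqVlt; apply/orP; left; apply/eqP.
by field; rewrite !gt_eqF.
Qed.

Lemma f_norm_cvg0P (x_ : nat -> leb_type R -> \bar R) :
  (forall m, X (x_ m)) ->
  f_norm s f rho_ (x_ m) @[m --> \oo] --> 0%E <->
  forall lambda : R, 0 < lambda -> forall i, (1 <= i < n)%N ->
    rho_ i (fscale lambda (x_ m)) @[m --> \oo] --> 0%E.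
Proof.
move=> Xx_; split=> [/nneg_cvge0P fc lambda l0 i hi|rhoc].
  apply/nneg_cvge0P => [m|e e0]; first by apply: semimodular_ge0 hi (subspace_fscale _ _).
  have [C [D [C0 D0 CD]]] := f_norm_lt_semimodular_le l0.
  (* The first term makes the estimate applicable; the second makes its bound [C * e'] at most
     [e / 2]. *)
  pose e' := Num.min D (e / (2 * C)).
  have e'0 : 0 < e' by rewrite lt_min D0 divr_gt0// mulr_gt0.
  apply: filterS (fc (fun m => f_norm_ge0 _) e' e'0) => m xe'.
  apply: le_lt_trans (CD _ _ (Xx_ m) e'0 _ xe' i hi) _; first by rewrite ge_min lexx.
  rewrite lte_fin (@le_lt_trans _ _ (C * (e / (2 * C))))//.
    by rewrite ler_pM2l// ge_min lexx orbT.
  have -> : C * (e / (2 * C)) = e / 2 by field; rewrite gt_eqF.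
  by lra.
apply/nneg_cvge0P => [m|e e0]; first exact: f_norm_ge0.
have [M M0 fM] := ext_f_ub n2 f_is_norm f_mono.
(* Once all [rho_ i (x_m / k^(1/s))] are below 1, this [k] contributes at most [k * M = e / 2] to
   the infimum. *)
pose k := e / (2 * M); have k0 : 0 < k by rewrite divr_gt0// mulr_gt0.
suff : \forall m \near \oo, forall j : 'I_n, (0 < j)%N ->
    (rho_ j (fscale (k `^ s^-1)^-1 (x_ m)) < 1%:E)%E.
  apply: filterS => m rho1; apply: (@le_lt_trans _ _ (k%:E * M%:E)%E).
    apply: (@le_trans _ _ (k%:E * ext_f f
        (fun i => rho_ i (fscale (k `^ s^-1)^-1 (x_ m))))%E).
      by apply: ereal_inf_lbound; exists k.
    apply: lee_wpmul2l; rewrite ?lee_fin ?(ltW k0)//; apply: fM => j hj.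
    rewrite semimodular_ge0//=; last exact: subspace_fscale.
    by have /andP[j0 jn] := hj; exact/ltW/(rho1 (Ordinal jn)).
  rewrite -EFinM lte_fin.
  have -> : k * M = e / 2 by rewrite /k; field; rewrite gt_eqF.
  by lra.
apply: filter_forall => j; have [j0|] := ltnP 0 j; last by move=> _; exact: nearW.
have hj : (1 <= j < n)%N by rewrite j0/=.
have : \forall m \near \oo, (rho_ j (fscale (k `^ s^-1)^-1 (x_ m)) < 1%:E)%E.
  apply: (nneg_cvge0P _).1 ltr01 => [m|].
    by apply: semimodular_ge0 hj (subspace_fscale _ _).
  by apply: rhoc => //; rewrite invr_gt0 powR_gt0.
exact: filterS.
Qed.

End f_norm_convergence.

(** * Order continuity reduced to decreasing sequences *)

Theorem theorem4p5 (R : realType) (alpha : \bar R)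
    (halpha : alpha = 1%E \/ alpha = +oo%E)
    (X : set (leb_type R -> \bar R))
    (hX : linear_subspace (base_itv alpha) X)
    (s : R) (hs : 0 < s <= 1)
    (n : nat) (hn : (2 <= n)%N)
    (rho_ : nat -> (leb_type R -> \bar R) -> \bar R)
    (hrho : forall i, (1 <= i < n)%N ->
       sconvex_semimodular (base_itv alpha) X s (rho_ i)) :
  let I := base_itv alpha in
  let rho := max_modular n rho_ in
  let Xrho := modular_space X rho in
  (* (i) *)
  (forall x y, Xrho x -> L0 I y ->
     {ae leb R, forall t, I t -> (`|y t| <= `|x t|)%E} ->
     Xrho y /\
     forall (lambda : R) i, 0 < lambda -> (1 <= i < n)%N ->
       (rho_ i (fscale lambda y) <= rho_ i (fscale lambda x))%E) ->
  (* (ii) *)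
  (exists2 x, Xrho x & {ae leb R, forall t, I t -> (0 < x t)%E}) ->
  (* (iii) *)
  (forall x_ : nat -> leb_type R -> \bar R, (forall m, Xrho (x_ m)) ->
     (forall lambda : R, 0 < lambda ->
        rho (fscale lambda (fsub (x_ p.1) (x_ p.2)))
          @[p --> filter_prod \oo \oo] --> 0%E) ->
     exists2 x, Xrho x &
       forall lambda : R, 0 < lambda ->
         rho (fscale lambda (fsub (x_ m) x)) @[m --> \oo] --> 0%E) ->
  forall f : 'rV[R]_n -> R, is_norm f ->
  (forall u v : nat -> R,
     (forall j, (1 <= j < n)%N -> 0 <= u j /\ u j <= v j) ->
     f (e1_plus n u) <= f (e1_plus n v)) ->
  order_continuous I Xrho (f_norm s f rho_) <->
  (forall (lambda : R) (x_ : nat -> leb_type R -> \bar R), 0 < lambda ->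
     (forall m, nonneg_part I Xrho (x_ m)) -> ae_decreases_to0 I x_ ->
     rho (fscale lambda (x_ m)) @[m --> \oo] --> 0%E).
Proof.
move=> I rho Xrho mono _ _ f f_is_norm f_mono; have /andP[s0 _] := hs.
have [XL0 _ _ _ [_ XZ]] := hX.
have rhoP (x_ : nat -> leb_type R -> \bar R) lambda : (forall m, Xrho (x_ m)) ->
    rho (fscale lambda (x_ m)) @[m --> \oo] --> 0%E <->
    forall i, (1 <= i < n)%N -> rho_ i (fscale lambda (x_ m)) @[m --> \oo] --> 0%E.
  move=> Xx_; apply: (max_modular_cvg0P (x_ := fun m => fscale lambda (x_ m)) hn).
  by move=> i m hi; exact: (semimodular_ge0 hrho hi (XZ _ _ (Xx_ m).1)).
have normP (x_ : nat -> leb_type R -> \bar R) : (forall m, Xrho (x_ m)) ->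
    f_norm s f rho_ (x_ m) @[m --> \oo] --> 0%E <->
    forall lambda : R, 0 < lambda ->
      rho (fscale lambda (x_ m)) @[m --> \oo] --> 0%E.
  move=> Xx_; rewrite (f_norm_cvg0P hX s0 hn hrho f_is_norm f_mono
    (fun m => (Xx_ m).1)).
  by split=> h lambda l0; apply/(rhoP x_ lambda Xx_); exact: h.
split=> [oc lambda x_ l0 Xx_ dec|rhoc x x_ Xx Xx_ xx xc].
  apply: (normP _ _).1 l0 => [m|]; first exact: (Xx_ m).1.
  (* A decreasing sequence is dominated by its first term. *)
  apply: (oc (x_ 0) x_) => //; first exact: (Xx_ 0).1.
    move=> m; apply: filterS dec => t + It => /(_ It)[dec _].
    apply: le_trans (lee_abs _); elim: m => // m; exact: le_trans.
  by apply: filterS dec => t + It => /(_ It)[].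
(* The tails [y m = sup_(j >= m) x_ j] decrease to 0 and stay below [|x|]. *)
pose y m : leb_type R -> \bar R := fun t => esups (x_ ^~ t) m.
have xy m t : (x_ m t <= y m t)%E by apply: ereal_sup_ubound; exists m => /=.
(* The countably many exceptional null sets are merged into one, so that suprema over the index can
   be estimated pointwise. *)
have /ae_foralln x0 m : {ae leb R, forall t, I t -> (0 <= x_ m t)%E} := (Xx_ m).2.
have yL0 m : L0 I (y m).
  by apply: measurable_fun_esups => j; exact/XL0/(Xx_ j).1.1.
have y0 : {ae leb R, forall t, I t -> forall m, (0 <= y m t)%E}.
  by apply: filterS x0 => t + It m => /(_ m It) h; exact: le_trans h (xy m t).
have yx m : {ae leb R, forall t, I t -> (`|y m t| <= `|x t|)%E}.
  move/ae_foralln: xx => xx; apply: filterS2 y0 xx => t + + It.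
  move=> /(_ It m) ym0 xxt; rewrite gee0_abs//.
  by apply: ge_ereal_sup => _ [j _ <-]; exact: xxt.
have Xy m : Xrho (y m) by exact: (mono _ _ Xx (yL0 m) (yx m)).1.
apply: (normP _ _).2 => [m|lambda l0]; first exact: (Xx_ m).1.
have X_x m : Xrho (x_ m) by exact: (Xx_ m).1.
apply/(rhoP x_ lambda X_x) => i hi.
have {rhoc} yc : rho (fscale lambda (y m)) @[m --> \oo] --> 0%E.
  apply: rhoc => // [m|].
    by split=> //; apply: filterS y0 => t + It => /(_ It).
  apply: filterS xc => t + It => /(_ It) xct; split; last exact: cvg_esups.
  by move=> m; exact: nonincreasing_esups.
(* As [0 <= x_ m <= y m] a.e., monotonicity (i), which is available for each [rho_ i], places
   [rho_ i (lambda x_m)] between 0 and [rho_ i (lambda y_m)]. *)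
apply: squeeze_cvge ((rhoP y lambda Xy).1 yc i hi); last exact: cvg_cst.
apply: nearW => m; rewrite (semimodular_ge0 hrho hi (XZ _ _ (X_x m).1))/=.
apply: (mono _ _ (Xy m) (XL0 _ (X_x m).1) _).2 => //.
apply: filterS2 x0 y0 => t + + It => /(_ m It) xm0 /(_ It m) ym0.
by rewrite !gee0_abs.
Qed.
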